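(* Let $X: g=0$ be a reduced hypersurface of degree $d$ in $\mathbb{C}^n$, and let $D: f=0$ be its closure in $\mathbb{P}^n$, where $f$ is the degree $d$ homogenization of $g$. For any integer $s$, the map $\phi:AR(f)\to AR(g)$, $$\phi(a_0,\ldots,a_n)=\bigl(d\,\theta(a_0),\theta(a_1)-x_1\theta(a_0),\ldots,\theta(a_n)-x_n\theta(a_0)\bigr),$$ induces an isomorphism of $\mathbb{C}$-vector spaces $$\phi_s: AR(f)_s\to AR(g)_{\le s}.$$ In particular, setting $mdr(f)=\min\{r : AR(f)_r\neq 0\}$ and $mdr(g)=\min\{r : AR(g)_{\le r}\neq 0\}$, one has $$mdr(g)=mdr(f)\le d-1.$$
   Context: $R=\mathbb{C}[x_1,\ldots,x_n]$, $S=\mathbb{C}[x_0,x_1,\ldots,x_n]$ (standard grading). The polynomial $g\in R$ is nonconstant and reduced (square-free) of degree $d$, and $f=x_0^d\, g(x_1/x_0,\ldots,x_n/x_0)\in S$. Write $g_j=\partial g/\partial x_j$ ($1\le j\le n$), $f_j=\partial f/\partial x_j$ ($0\le j\le n$), and $\theta:S\to R$, $\theta(u)=u(1,x_1,\ldots,x_n)$. Define $$AR(g)=\{(\alpha_0,\ldots,\alpha_n)\in R^{n+1} : \alpha_0 g+\alpha_1g_1+\cdots+\alpha_ng_n=0\},$$ $$AR(f)=\{(a_0,\ldots,a_n)\in S^{n+1} : a_0f_0+\cdots+a_nf_n=0\},$$ the latter graded so that $AR(f)_s$ consists of the syzygies whose entries are all homogeneous of degree $s$ (or zero). The syzygy-degree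 of a nonzero $\rho'=(\alpha_0,\ldots,\alpha_n)\in AR(g)$ is $$sdeg(\rho')=\max\{\deg\alpha_0,\ \deg(d\cdot\alpha_j+x_j\alpha_0)\text{ for }1\le j\le n\},$$ with $\deg 0=-\infty$, and $AR(g)_{\le s}=\{\rho'\in AR(g): sdeg(\rho')\le s\}$ (the zero syzygy being included for every $s$). *)

(* Defs.v *)
From HB Require Import structures.
From mathcomp Require Import all_boot all_order all_algebra.
From mathcomp Require Import mpoly complex.
From mathcomp Require Import constructive_ereal reals.

Set Implicit Arguments.
Unset Strict Implicit.
Unset Printing Implicit Defensive.

Import Order.TTheory GRing.Theory Num.Theory.
Local Open Scope ring_scope.

(* Throughout, {mpoly K[n]} is K[x_1, ..., x_n], where x_j is 'X_j' with
   j' = j - 1 : 'I_n, and {mpoly K[n.+1]} is K[x_0, ..., x_n], where x_0 is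
   'X_ord0 and x_j is 'X_(lift ord0 j').  Tuples (a_0, ..., a_n) are indexed
   by 'I_n.+1 in the same way. *)

Section Syzygies.

Variable K : fieldType.
Implicit Types (n d : nat) (s r : int).

Definition squarefree n (g : {mpoly K[n]}) : Prop :=
  forall h k : {mpoly K[n]}, g = h ^+ 2 * k -> h \is a GRing.unit.

(* The expansion of x_0^d g(x_1/x_0, ..., x_n/x_0), see homogenizeE. *)
Definition homogenize n d (g : {mpoly K[n]}) : {mpoly K[n.+1]} :=
  \sum_(m <- msupp g)
    g@_m *: ('X_ord0 ^+ (d - mdeg m) * \prod_(j < n) 'X_(lift ord0 j) ^+ m j).

Lemma homogenizeE n d (g : {mpoly K[n]}) : (msize g <= d.+1)%N ->
  tofrac (homogenize d g) =
    tofrac 'X_ord0 ^+ d *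
    mmap (fun c => tofrac c%:MP)
         (fun j => tofrac 'X_(lift ord0 j) / tofrac 'X_ord0) g
  :> {fraction {mpoly K[n.+1]}}.
Proof.
move=> le_gd; rewrite /homogenize /mmap rmorph_sum mulr_sumr /=.
have X0 : tofrac ('X_ord0 : {mpoly K[n.+1]}) != 0.
  by rewrite tofrac_eq0 -msize_poly_eq0 msizeX.
apply: eq_big_seq => m m_g.
have le_md : (mdeg m <= d)%N by have := leq_trans (msize_mdeg_lt m_g) le_gd.
rewrite -mul_mpolyC !rmorphM rmorphXn rmorph_prod /mmap1 /= [RHS]mulrCA.
congr (tofrac _ * _).
have -> : tofrac 'X_ord0 ^+ (d - mdeg m)
    = tofrac 'X_ord0 ^+ d * \prod_(j < n) (tofrac 'X_ord0)^-1 ^+ m j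
    :> {fraction {mpoly K[n.+1]}}.
  rewrite prodrXr -mdegE exprVn -{2}(subnK le_md) exprD mulfK //.
  by rewrite expf_neq0.
rewrite -mulrA -big_split; congr (_ * _); apply: eq_bigr => j _.
by rewrite rmorphXn /= mulrC exprMn.
Qed.

Definition dehomogenize n (u : {mpoly K[n.+1]}) : {mpoly K[n]} :=
  u \mPo [tuple of 1 :: [tuple 'X_j | j < n]].

Definition mpdeg n (p : {mpoly K[n]}) : \bar int :=
  if p == 0 then -oo%E else (msize p).-1%:Z%:E.

(* Homogeneous of degree s or zero; for s < 0 only zero qualifies. *)
Definition homog_deg n s (p : {mpoly K[n]}) : bool :=
  if s is Posz k then p \is k.-homog else p == 0.

Definition AR_hom n (f : {mpoly K[n.+1]}) :
    {pred {ffun 'I_n.+1 -> {mpoly K[n.+1]}}} :=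
  fun a => \sum_(i < n.+1) a i * f^`M(i) == 0.

Definition AR_hom_deg n (f : {mpoly K[n.+1]}) s :
    {pred {ffun 'I_n.+1 -> {mpoly K[n.+1]}}} :=
  fun a => (a \in AR_hom f) && [forall i, homog_deg s (a i)].

Definition AR_aff n (g : {mpoly K[n]}) :
    {pred {ffun 'I_n.+1 -> {mpoly K[n]}}} :=
  fun al => al ord0 * g + \sum_(j < n) al (lift ord0 j) * g^`M(j) == 0.

Definition sdeg n d (al : {ffun 'I_n.+1 -> {mpoly K[n]}}) : \bar int :=
  Order.max (mpdeg (al ord0))
    (\big[Order.max/-oo%E]_(j < n)
        mpdeg (d%:R * al (lift ord0 j) + 'X_j * al ord0)).

(* The zero syzygy belongs to this set for every s, as sdeg d 0 = -oo. *)
Definition AR_aff_le n d (g : {mpoly K[n]}) s :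
    {pred {ffun 'I_n.+1 -> {mpoly K[n]}}} :=
  fun al => (al \in AR_aff g) && (sdeg d al <= s%:E)%E.

Definition phi n d (a : {ffun 'I_n.+1 -> {mpoly K[n.+1]}}) :
    {ffun 'I_n.+1 -> {mpoly K[n]}} :=
  [ffun i => if unlift ord0 i is Some j
             then dehomogenize (a i) - 'X_j * dehomogenize (a ord0)
             else d%:R * dehomogenize (a ord0)].

Lemma homog_deg_submod n s : submod_closed (@homog_deg n s).
Proof.
case: s => k /=; first exact: dhomog_submod_closed.
split=> [|c p q]; rewrite !unfold_in //= => /eqP-> /eqP->.
by rewrite scaler0 addr0.
Qed.

Lemma mpdeg_leP n (p : {mpoly K[n]}) s :
  reflect (forall m, m \in msupp p -> (mdeg m)%:Z <= s) (mpdeg p <= s%:E)%E.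
Proof.
rewrite /mpdeg; have [->|p_neq0] := eqVneq p 0.
  by rewrite leNye; constructor=> m; rewrite msupp0.
rewrite lee_fin; apply: (iffP idP) => [le_ps m m_p|/(_ _ (mlead_supp p_neq0))].
  by apply: le_trans le_ps; have := msize_mdeg_lt m_p; rewrite lez_nat; case: (msize p).
by rewrite -mlead_deg.
Qed.

Lemma mpdeg_le_submod n s :
  submod_closed (fun p : {mpoly K[n]} => (mpdeg p <= s%:E)%E).
Proof.
split=> [|c p q /mpdeg_leP le_ps /mpdeg_leP le_qs].
  by apply/mpdeg_leP => m; rewrite msupp0.
apply/mpdeg_leP => m /msuppD_le; rewrite mem_cat => /orP[/msuppZ_le|]; [exact: le_ps|exact: le_qs].
Qed.

Lemma sdeg_le n d (al : {ffun 'I_n.+1 -> {mpoly K[n]}}) s :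
  (sdeg d al <= s%:E)%E =
  (mpdeg (al ord0) <= s%:E)%E &&
  [forall j : 'I_n,
    (mpdeg (d%:R * al (lift ord0 j) + 'X_j * al ord0) <= s%:E)%E].
Proof.
rewrite /sdeg ge_max; congr (_ && _).
apply/bigmax_leP/forallP => [[_ h] j|h]; first exact: h.
by split=> [|j _]; [rewrite leNye|exact: h].
Qed.

Lemma AR_hom_deg_submod n (f : {mpoly K[n.+1]}) s :
  submod_closed (AR_hom_deg f s).
Proof.
have [h0 hD] := homog_deg_submod n.+1 s.
split=> [|c a b].
  rewrite !unfold_in big1 ?eqxx /= => [|i _]; last by rewrite ffunE mul0r.
  by apply/forallP => i; rewrite ffunE.
rewrite !unfold_in => /andP[/eqP a0 /forallP ah] /andP[/eqP b0 /forallP bh].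
apply/andP; split; last by apply/forallP => i; rewrite !ffunE; exact: (hD c _ _ (ah i) (bh i)).
under eq_bigr do rewrite !ffunE mulrDl -scalerAl.
by rewrite big_split /= -scaler_sumr a0 b0 scaler0 addr0.
Qed.

Lemma AR_aff_le_submod n d (g : {mpoly K[n]}) s :
  submod_closed (AR_aff_le d g s).
Proof.
have [h0 hD] := mpdeg_le_submod n s.
split=> [|c a b].
  rewrite !unfold_in sdeg_le !ffunE mul0r add0r big1 => [|j _].
    apply/and3P; split=> //; apply/forallP => j.
    by rewrite !ffunE !mulr0 addr0; exact: h0.
  by rewrite ffunE mul0r.
rewrite !unfold_in !sdeg_le.
move=> /and3P[/eqP a0 ah0 /forallP ah] /and3P[/eqP b0 bh0 /forallP bh].
apply/and3P; split.
- under eq_bigr do rewrite !ffunE mulrDl -scalerAl.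
  rewrite !ffunE mulrDl -scalerAl big_split /= -scaler_sumr addrACA -scalerDr.
  by rewrite a0 b0 scaler0 addr0.
- rewrite !ffunE; exact: (hD c _ _ ah0 bh0).
- apply/forallP => j; rewrite !ffunE !mulrDr -!scalerAr addrACA -scalerDr.
  exact: (hD c _ _ (ah j) (bh j)).
Qed.

HB.instance Definition _ n (f : {mpoly K[n.+1]}) s :=
  GRing.isSubmodClosed.Build K {ffun 'I_n.+1 -> {mpoly K[n.+1]}}
    (AR_hom_deg f s) (AR_hom_deg_submod f s).

HB.instance Definition _ n d (g : {mpoly K[n]}) s :=
  GRing.isSubmodClosed.Build K {ffun 'I_n.+1 -> {mpoly K[n]}}
    (AR_aff_le d g s) (AR_aff_le_submod d g s).

(* The C-vector spaces AR(f)_s and AR(g)_{<= s}, for K = C. *)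
Record ARf n (f : {mpoly K[n.+1]}) s := MkARf {
  ARf_val :> {ffun 'I_n.+1 -> {mpoly K[n.+1]}};
  _ : ARf_val \in AR_hom_deg f s }.

Record ARg n d (g : {mpoly K[n]}) s := MkARg {
  ARg_val :> {ffun 'I_n.+1 -> {mpoly K[n]}};
  _ : ARg_val \in AR_aff_le d g s }.

HB.instance Definition _ n (f : {mpoly K[n.+1]}) s :=
  [isSub for @ARf_val n f s].
HB.instance Definition _ n (f : {mpoly K[n.+1]}) s :=
  [Choice of ARf f s by <:].
HB.instance Definition _ n (f : {mpoly K[n.+1]}) s :=
  [SubChoice_isSubLmodule of ARf f s by <:].

HB.instance Definition _ n d (g : {mpoly K[n]}) s :=
  [isSub for @ARg_val n d g s].
HB.instance Definition _ n d (g : {mpoly K[n]}) s :=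
  [Choice of ARg d g s by <:].
HB.instance Definition _ n d (g : {mpoly K[n]}) s :=
  [SubChoice_isSubLmodule of ARg d g s by <:].

Definition is_min (P : int -> Prop) r : Prop :=
  P r /\ forall r', P r' -> r <= r'.

Definition is_mdr_hom n (f : {mpoly K[n.+1]}) r : Prop :=
  is_min (fun t => exists a : ARf f t, a != 0) r.

Definition is_mdr_aff n d (g : {mpoly K[n]}) r : Prop :=
  is_min (fun t => exists al : ARg d g t, al != 0) r.

End Syzygies.

(* Main.v *)
Require Import Defs.
From HB Require Import structures.
From mathcomp Require Import all_boot all_order all_algebra.
From mathcomp Require Import mpoly complex boolp.
From mathcomp Require Import constructive_ereal reals.

Set Implicit Arguments.
Unset Strict Implicit.
Unset Printing Implicit Defensive.

Import Order.TTheory GRing.Theory Num.Theory.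
Local Open Scope ring_scope.

(* Restricted to homogeneous polynomials of a fixed degree, setting x_0 = 1 is
   injective, and homogenization inverts it. Euler's formula for f, read at
   x_0 = 1, expresses theta(f_0) through g and its partial derivatives and gives
     theta(sum_i a_i f_i) = phi(a)_0 g + sum_j phi(a)_j g_j.
   So phi sends syzygies of f to syzygies of g; conversely, for entries a_i
   homogeneous of degree s the left-hand sum is homogeneous, so that a is a
   syzygy of f as soon as phi(a) is one of g. As phi(a)_0 = d theta(a_0) and
   d phi(a)_j + x_j phi(a)_0 = d theta(a_j), the condition sdeg <= s bounds
   exactly the degrees of the theta(a_i), which then homogenize to degree s. *)

(** * Homogenization, setting x_0 = 1, and derivatives, computed on monomials *)

Section Homogenization.

Variables (K : fieldType) (n : nat).
Implicit Types (d k : nat) (g p : {mpoly K[n]}) (u v : {mpoly K[n.+1]}).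

Definition mnm_dehomog (m : 'X_{1..n.+1}) : 'X_{1..n} :=
  [multinom m (lift ord0 j) | j < n].

Definition mnm_homog d (m : 'X_{1..n}) : 'X_{1..n.+1} :=
  [multinom oapp m (d - mdeg m)%N (unlift ord0 i) | i < n.+1].

Lemma mdeg_dehomog m : mdeg m = (m ord0 + mdeg (mnm_dehomog m))%N.
Proof.
rewrite !mdegE big_ord_recl; congr (_ + _)%N.
by apply: eq_bigr => j _; rewrite mnmE.
Qed.

Lemma mnm_homogK d : cancel (mnm_homog d) mnm_dehomog.
Proof. by move=> m; apply/mnmP => j; rewrite mnmE mnmE liftK. Qed.

Lemma mdeg_homog d m : (mdeg m <= d)%N -> mdeg (mnm_homog d m) = d.
Proof.
by move=> le_md; rewrite mdeg_dehomog mnm_homogK mnmE unlift_none subnK.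
Qed.

(** The exponent of x_0 is the total degree minus the degree in the other variables. *)
Lemma mnm_dehomog_inj m m' :
  mdeg m = mdeg m' -> mnm_dehomog m = mnm_dehomog m' -> m = m'.
Proof.
rewrite !mdeg_dehomog => eq_deg eq_m.
move: eq_deg; rewrite eq_m => /addIn eq0; apply/mnmP => i.
case: (unliftP ord0 i) => [j|] -> //.
by have /mnmP/(_ j) := eq_m; rewrite !mnmE.
Qed.

Lemma homogenizeEX d g :
  homogenize d g = \sum_(m <- msupp g) g@_m *: 'X_[mnm_homog d m].
Proof.
apply: eq_bigr => m _; congr (_ *: _).
rewrite [in RHS]mpolyXE_id big_ord_recl mnmE unlift_none; congr (_ * _).
by apply: eq_bigr => j _; rewrite mnmE liftK.
Qed.

Lemma homogenize_homog d g : (msize g <= d.+1)%N -> homogenize d g \is d.-homog.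
Proof.
move=> le_gd; rewrite homogenizeEX big_seq; apply: rpred_sum => m m_g.
apply: dhomogZ; rewrite dhomogX; apply/eqP/mdeg_homog.
by have := leq_trans (msize_mdeg_lt m_g) le_gd.
Qed.

HB.instance Definition _ :=
  GRing.LRMorphism.copy (@dehomogenize K n)
    (comp_mpoly [tuple of 1 :: [tuple 'X_j | j < n]]).

Lemma dehomogenizeX m : dehomogenize 'X_[K, m] = 'X_[mnm_dehomog m].
Proof.
rewrite /dehomogenize comp_mpolyX big_ord_recl tnth0 expr1n mul1r mpolyXE_id.
by apply: eq_bigr => j _; rewrite tnthS tnth_mktuple mnmE.
Qed.

Lemma dehomogenizeE u :
  dehomogenize u = \sum_(m <- msupp u) u@_m *: 'X_[mnm_dehomog m].
Proof.
rewrite {1}[u]mpolyE raddf_sum; apply: eq_bigr => m _.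
by rewrite /= linearZ /= dehomogenizeX.
Qed.

(** The exponent of x_0, even where [d - mdeg m] truncates to 0, disappears at x_0 = 1. *)
Lemma homogenizeK d : cancel (@homogenize K n d) (@dehomogenize K n).
Proof.
move=> g; rewrite homogenizeEX [RHS]mpolyE raddf_sum; apply: eq_bigr => m _.
by rewrite /= linearZ /= dehomogenizeX mnm_homogK.
Qed.

Lemma msize_dehomogenize k u : u \is k.-homog -> (msize (dehomogenize u) <= k.+1)%N.
Proof.
move=> /dhomogP hom_u; rewrite dehomogenizeE big_seq.
elim/big_ind: _ => [|p q hp hq|m m_u]; first by rewrite msize0.
  by apply: leq_trans (msizeD_le _ _) _; rewrite geq_max hp hq.
apply: leq_trans (msizeZ_le _ _) _.
by rewrite msizeX ltnS -(hom_u _ m_u) [leqRHS]mdeg_dehomog leq_addl.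
Qed.

(** Distinct monomials of the same degree stay distinct at x_0 = 1, so no terms of [u] can cancel:
    each coefficient of [u] survives as a coefficient of the image. *)
Lemma dehomogenize_eq0 k u : u \is k.-homog -> (dehomogenize u == 0) = (u == 0).
Proof.
move=> /dhomogP hom_u; apply/eqP/eqP => [u0|->]; last exact: raddf0.
apply/eqP; rewrite -msupp_eq0; case E: (msupp u) => [//|m s].
have m_u : m \in msupp u by rewrite E mem_head.
have : (dehomogenize u)@_(mnm_dehomog m) != 0; last by rewrite u0 mcoeff0 eqxx.
rewrite dehomogenizeE raddf_sum /= (bigD1_seq m) ?msupp_uniq //=.
rewrite mcoeffZ mcoeffX eqxx mulr1 big_seq_cond big1 => [|m' /andP[m'_u ne_m]].
  by rewrite addr0 -mcoeff_msupp.
rewrite mcoeffZ mcoeffX; case: eqP => [eq_m|_]; last exact: mulr0.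
by case/eqP: ne_m; apply: mnm_dehomog_inj eq_m; rewrite [LHS]hom_u // [RHS]hom_u.
Qed.

Lemma mderiv_homog m k (p : {mpoly K[m]}) (i : 'I_m) :
  p \is k.-homog -> p^`M(i) \is k.-1.-homog.
Proof.
move=> /dhomogP hom_p; rewrite [p]mpolyE raddf_sum big_seq.
apply: rpred_sum => t t_p; rewrite /= mderivZ mderivX; apply: dhomogZ.
(* If x_i does not occur in [t], the truncated [t - U_(i)] is [t] itself and its degree does not
   drop, but its coefficient is 0. *)
have [->|ti0] := eqVneq (t i) 0%N; first by rewrite scale0r dhomog0.
apply: dhomogZ; rewrite dhomogX; apply/eqP.
have /submK eq_t : (U_(i) <= t)%MM.
  by apply/mnm_lepP => j; rewrite mnm1E; case: eqP => // <-; rewrite lt0n.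
by rewrite -(hom_p t t_p) -[in RHS]eq_t [RHS]/(mdeg _).-1 mdegD mdeg1 addn1.
Qed.

Lemma dehomogenize_mderiv (j : 'I_n) u :
  dehomogenize u^`M(lift ord0 j) = (dehomogenize u)^`M(j).
Proof.
rewrite [u]mpolyE (raddf_sum (mderiv _)) !(raddf_sum (@dehomogenize K n)).
rewrite (raddf_sum (mderiv _)); apply: eq_bigr => m _ /=.
rewrite mderivZ !linearZ /= dehomogenizeX !mderivX linearZ /= dehomogenizeX mnmE.
congr (_ *: (_ *: 'X_[_])); apply/mnmP => i.
by rewrite !(mnmE, mnmBE, mnm1E) (inj_eq lift_inj).
Qed.

(* Euler's formula [x_0 u_0 + ... + x_n u_n = k u], read at [x_0 = 1]. *)
Lemma dehomogenize_mderiv0 k u : u \is k.-homog ->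
  dehomogenize u^`M(ord0) =
  k%:R * dehomogenize u - \sum_(j < n) 'X_j * (dehomogenize u)^`M(j).
Proof.
move=> /dhomogP hom_u; apply/eqP; rewrite eq_sym subr_eq; apply/eqP.
have deh_u := dehomogenizeE u.
have -> : dehomogenize u^`M(ord0) =
    \sum_(m <- msupp u) u@_m *: ((m ord0)%:R *: 'X_[mnm_dehomog m]).
  rewrite [u in LHS]mpolyE (raddf_sum (mderiv _)) (raddf_sum (@dehomogenize K n)).
  apply: eq_bigr => m _ /=.
  have mU : mnm_dehomog (m - U_(ord0))%MM = mnm_dehomog m.
    by apply/mnmP => j; rewrite mnmE mnmBE mnm1E /= subn0 mnmE.
  by rewrite mderivZ mderivX linearZ /= linearZ /= dehomogenizeX mU.
have -> : \sum_(j < n) 'X_j * (dehomogenize u)^`M(j) =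
    \sum_(m <- msupp u) u@_m *: ((mdeg (mnm_dehomog m))%:R *: 'X_[mnm_dehomog m]).
  under eq_bigr do rewrite deh_u (raddf_sum (mderiv _)) mulr_sumr.
  rewrite exchange_big; apply: eq_bigr => m _ /=.
  rewrite mdegE natr_sum scaler_suml scaler_sumr; apply: eq_bigr => j _.
  rewrite mderivZ mderivX -!scalerAr -mpolyXD.
  have [->|mj_neq0] := eqVneq (mnm_dehomog m j) 0%N; first by rewrite !scale0r.
  rewrite [(U_(j) + _)%MM]addmC submK //.
  by apply/mnm_lepP => i; rewrite mnm1E; case: eqP => // <-; rewrite lt0n.
(* Monomial by monomial, it remains to see that [m ord0 + mdeg (mnm_dehomog m)] is [k]. *)
rewrite deh_u mulr_sumr -big_split; apply: eq_big_seq => m m_u /=.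
rewrite -scalerDr -scalerDl -natrD -mdeg_dehomog [mdeg m]hom_u //.
by rewrite mulr_natl scaler_nat -scalerMnr.
Qed.

End Homogenization.

(** * The map [phi] and its bijectivity in each degree *)

Section Syzygies.

Variables (K : fieldType) (n d : nat) (g : {mpoly K[n]}).
Hypotheses (dK : d%:R != 0 :> K) (deg_g : (msize g <= d.+1)%N).
Implicit Types a : {ffun 'I_n.+1 -> {mpoly K[n.+1]}}.
Local Notation f := (homogenize d g).

Lemma phi0 a : phi d a ord0 = d%:R * dehomogenize (a ord0).
Proof. by rewrite ffunE unlift_none. Qed.

Lemma phiS a j :
  phi d a (lift ord0 j) = dehomogenize (a (lift ord0 j)) - 'X_j * dehomogenize (a ord0).
Proof. by rewrite ffunE liftK. Qed.

Lemma phi_is_linear : linear (@phi K n d).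
Proof.
move=> c a b; apply/ffunP => i; rewrite !ffunE; case: unliftP => [j|] _.
  rewrite !linearP /= mulrDr -scalerAr scalerBr opprD !addrA; congr (_ + _).
  by rewrite addrAC.
by rewrite linearP /= mulrDr -scalerAr.
Qed.

Lemma phi_syzygyE a :
  phi d a ord0 * g + \sum_(j < n) phi d a (lift ord0 j) * g^`M(j) =
  dehomogenize (\sum_(i < n.+1) a i * f^`M(i)).
Proof.
rewrite raddf_sum big_ord_recl /= !rmorphM /=.
rewrite (dehomogenize_mderiv0 (homogenize_homog deg_g)) homogenizeK phi0.
rewrite mulrBr mulrA [_ * d%:R]mulrC -addrA; congr (_ + _).
under [in RHS]eq_bigr do rewrite rmorphM /= dehomogenize_mderiv homogenizeK.
rewrite mulr_sumr addrC -sumrB; apply: eq_bigr => j _.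
by rewrite phiS mulrBl mulrA [dehomogenize (a ord0) * _]mulrC.
Qed.

Lemma phi_AR a : a \in AR_hom f -> phi d a \in AR_aff g.
Proof.
by rewrite !unfold_in phi_syzygyE => /eqP ->; rewrite raddf0.
Qed.

Lemma mpdegZ_le m s (c : K) (p : {mpoly K[m]}) :
  (mpdeg p <= s%:E)%E -> (mpdeg (c *: p) <= s%:E)%E.
Proof.
have [le0 leD] := mpdeg_le_submod K m s.
by move=> p_s; rewrite -[c *: p]addr0; exact: leD.
Qed.

Lemma mpdeg_le_nat m (p : {mpoly K[m]}) k :
  (mpdeg p <= (Posz k)%:E)%E = (msize p <= k.+1)%N.
Proof.
rewrite /mpdeg; case: eqVneq => [->|p0]; first by rewrite leNye msize0.
by rewrite lee_fin lez_nat; move: p0; rewrite -msize_poly_eq0; case: (msize p).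
Qed.

Lemma mpdeg_le_neg m (p : {mpoly K[m]}) k : (mpdeg p <= (Negz k)%:E)%E = (p == 0).
Proof. by rewrite /mpdeg; case: eqVneq => [|p0]; rewrite ?leNye ?lee_fin. Qed.

Lemma mpdeg_dehomogenize s (u : {mpoly K[n.+1]}) :
  homog_deg s u -> (mpdeg (dehomogenize u) <= s%:E)%E.
Proof.
case: s => k /=; rewrite ?mpdeg_le_nat ?mpdeg_le_neg; first exact: msize_dehomogenize.
by move=> /eqP ->; rewrite raddf0.
Qed.

Lemma dehomogenize_homog_deg_eq0 s (u : {mpoly K[n.+1]}) :
  homog_deg s u -> dehomogenize u = 0 -> u = 0.
Proof.
case: s => k /= hom_u; last by rewrite (eqP hom_u).
by move/eqP; rewrite (dehomogenize_eq0 hom_u) => /eqP.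
Qed.

(** For [s] nonnegative, [p] is homogenized to degree exactly [s], a power of x_0 making up for a
    smaller degree; for [s] negative the bound forces [p = 0]. *)
Lemma dehomogenize_surj s (p : {mpoly K[n]}) : (mpdeg p <= s%:E)%E ->
  exists2 u, homog_deg s u & dehomogenize u = p.
Proof.
case: s => k; rewrite ?mpdeg_le_nat ?mpdeg_le_neg => hp.
  by exists (homogenize k p); [exact: homogenize_homog|exact: homogenizeK].
by exists 0; rewrite /= ?raddf0 ?(eqP hp).
Qed.

Lemma phi_AR_le s a : a \in AR_hom_deg f s -> phi d a \in AR_aff_le d g s.
Proof.
case/andP => a_f /forallP a_s; apply/andP; split; first exact: phi_AR.
rewrite sdeg_le phi0.
have le_d p : (mpdeg p <= s%:E)%E -> (mpdeg (d%:R * p : {mpoly K[n]}) <= s%:E)%E.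
  by rewrite mulr_natl -scaler_nat; exact: mpdegZ_le.
apply/andP; split; first by apply/le_d/mpdeg_dehomogenize.
apply/forallP => j; rewrite phiS mulrBr.
(* The two terms d x_j theta(a_0) cancel, leaving d theta(a_j). *)
by rewrite [d%:R * (_ * _)]mulrCA subrK; apply/le_d/mpdeg_dehomogenize.
Qed.

Lemma natr_mulK (p : {mpoly K[n]}) : d%:R * (d%:R^-1 *: p) = p.
Proof. by rewrite mulr_natl -scaler_nat scalerA mulfV ?scale1r. Qed.

(** Since d is invertible in [K], entry 0 gives theta(a_0) = 0; the other entries then reduce to
    theta(a_j) = 0, and homogeneity gives a = 0. *)
Lemma phi_inj s a : a \in AR_hom_deg f s -> phi d a = 0 -> a = 0.
Proof.
case/andP => _ /forallP a_s /ffunP phi_a.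
have a0 : dehomogenize (a ord0) = 0.
  have := phi_a ord0; rewrite phi0 ffunE mulr_natl -scaler_nat => /eqP.
  by rewrite scaler_eq0 (negPf dK) => /eqP.
apply/ffunP => i; rewrite ffunE; apply: (dehomogenize_homog_deg_eq0 (a_s i)).
case: (unliftP ord0 i) => [j|] -> //.
by have := phi_a (lift ord0 j); rewrite phiS a0 mulr0 subr0 ffunE.
Qed.

Lemma AR_homP s a : (forall i, homog_deg s (a i)) ->
  phi d a \in AR_aff g -> a \in AR_hom f.
Proof.
move=> a_s; rewrite !unfold_in phi_syzygyE.
case: s a_s => k /= a_s; last first.
  by move=> _; rewrite big1 // => i _; rewrite (eqP (a_s i)) mul0r.
(* Each product a_i f_i is homogeneous of degree k + (d - 1). *)
rewrite (@dehomogenize_eq0 _ _ (k + d.-1)%N) //; apply: rpred_sum => i _.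
by apply: dhomogM => //; apply/mderiv_homog/homogenize_homog.
Qed.

Lemma phi_surj s al : al \in AR_aff_le d g s ->
  exists2 a, a \in AR_hom_deg f s & phi d a = al.
Proof.
case/andP => al_g; rewrite sdeg_le => /andP[al0 /forallP alS].
(* Solving phi(a) = al for the theta(a_i) gives theta(a_0) = al_0 / d and theta(a_j) = (d al_j + x_j
   al_0) / d, whose degrees are those bounded by [sdeg]. *)
have [u0 u0_s u0E] := dehomogenize_surj (mpdegZ_le d%:R^-1 al0).
have /fin_all_exists2[u u_s uE] j := dehomogenize_surj (mpdegZ_le d%:R^-1 (alS j)).
pose a := [ffun i => oapp u u0 (unlift ord0 i)].
have a_s i : homog_deg s (a i) by rewrite ffunE; case: unlift.
have phi_a : phi d a = al.
  apply/ffunP => i; case: (unliftP ord0 i) => [j|] ->.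
    rewrite phiS !ffunE liftK unlift_none /= u0E uE.
    by rewrite scalerDr -scalerAr addrK scalerAr natr_mulK.
  by rewrite phi0 ffunE unlift_none u0E natr_mulK.
exists a => //; apply/andP; split; last exact/forallP.
by apply: (AR_homP a_s); rewrite phi_a.
Qed.

Definition phi_deg s (a : ARf f s) : ARg d g s := MkARg (phi_AR_le (valP a)).

Lemma phi_deg_is_linear s : linear (@phi_deg s).
Proof. by move=> c a b; apply: val_inj; rewrite /= phi_is_linear. Qed.

HB.instance Definition _ s :=
  GRing.isLinear.Build K (ARf f s) (ARg d g s) _ (@phi_deg s) (@phi_deg_is_linear s).

Lemma phi_deg_bij s : bijective (@phi_deg s).
Proof.
have inj : injective (@phi_deg s).
  apply: raddf_inj => a /(congr1 val) /= /(phi_inj (valP a)) a0.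
  exact: val_inj.
(* Stated with the boolean [==], so that [xchoose] can select preimages and define the inverse. *)
have surj al : exists a : ARf f s, phi_deg a == al.
  have [a a_f phi_a] := phi_surj (valP al).
  by exists (MkARf a_f); apply/eqP/val_inj.
exists (fun al => xchoose (surj al)) => [a|al].
  by apply: inj; apply/eqP/(xchooseP (surj _)).
exact/eqP/(xchooseP (surj al)).
Qed.

(** Makes the two minimal degrees minima of the same set of integers. *)
Lemma ARf_ARg_neq0 s :
  (exists a : ARf f s, a != 0) <-> (exists al : ARg d g s, al != 0).
Proof.
have [psi phiK psiK] := phi_deg_bij s; split=> -[x x0].
  exists (phi_deg x); apply: contraNneq x0 => phi_x.
  by rewrite -(inj_eq (can_inj phiK)) phi_x raddf0.
by exists (psi x); rewrite -(inj_eq (can_inj phiK)) psiK raddf0.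
Qed.

End Syzygies.

(** * The minimal degree of a syzygy and its bound *)

(** Confines the search for a minimum over [int] to the natural numbers, where a least element
    exists. *)
Lemma AR_hom_deg_neg (K : fieldType) n (f : {mpoly K[n.+1]}) k (a : ARf f (Negz k)) : a = 0.
Proof.
case: a => a aP; apply: val_inj; case/andP: (aP) => _ /forallP a0.
by apply/ffunP => i; rewrite ffunE; apply/eqP; exact: a0.
Qed.

(* The Koszul syzygy [(f_j, 0, ..., 0, - f_0, 0, ..., 0)], unless [f_0 = 0]: then
   [(1, 0, ..., 0)] is a syzygy. *)
Lemma exists_small_syzygy (K : fieldType) n d (f : {mpoly K[n.+1]}) (j : 'I_n) :
  f \is d.-homog -> exists2 k, (k <= d.-1)%N & exists a : ARf f (Posz k), a != 0.
Proof.
move=> hom_f; have [f0|f0] := eqVneq f^`M(ord0) 0.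
  pose a := [ffun i : 'I_n.+1 => if i == ord0 then 1 else 0 : {mpoly K[n.+1]}].
  exists 0%N => //; have aP : a \in AR_hom_deg f 0%N.
    apply/andP; split; last first.
      by apply/forallP => i; rewrite ffunE /=; case: ifP => _; rewrite ?dhomog1 ?dhomog0.
    rewrite unfold_in big_ord_recl f0 mulr0 add0r big1 // => i _.
    by rewrite ffunE mul0r.
  exists (MkARf aP); apply/eqP => /(congr1 val)/ffunP/(_ ord0)/eqP.
  by rewrite /= !ffunE oner_eq0.
pose a := [ffun i : 'I_n.+1 => if i == ord0 then f^`M(lift ord0 j)
   else if i == lift ord0 j then - f^`M(ord0) else 0].
exists d.-1 => //; have aP : a \in AR_hom_deg f d.-1.
  apply/andP; split; last first.
    apply/forallP => i; rewrite ffunE /=.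
    by do 2?case: ifP => _; rewrite ?dhomog0 ?dhomogN ?mderiv_homog.
  rewrite unfold_in big_ord_recl (bigD1 j) //= !ffunE /= eqxx big1 => [|i ne_ij].
    by rewrite addr0 mulNr mulrC subrr.
  by rewrite ffunE (inj_eq lift_inj) (negPf ne_ij) mul0r.
exists (MkARf aP); apply/eqP => /(congr1 val)/ffunP/(_ (lift ord0 j))/eqP.
by rewrite /= !ffunE eqxx oppr_eq0 (negPf f0).
Qed.

Theorem corollary2p9 (R : realType) (n d : nat) (g : {mpoly R[i][n]})
    (d_gt0 : (0 < d)%N) (deg_g : msize g = d.+1) (g_red : squarefree g) :
  let f := homogenize d g in
  [/\ forall a, a \in AR_hom f -> phi d a \in AR_aff g,
      forall s : int, exists phi_s : {linear ARf f s -> ARg d g s},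
        (forall a, val (phi_s a) = phi d (val a)) /\ bijective phi_s
    & exists r : int,
        [/\ is_mdr_aff d g r, is_mdr_hom f r & r <= d%:Z - 1]].
Proof.
move=> f.
have dK : d%:R != 0 :> R[i] by rewrite pnatr_eq0 -lt0n.
have le_gd : (msize g <= d.+1)%N by rewrite deg_g.
split=> [a|s|]; first exact: phi_AR.
  exists (@phi_deg _ n d g le_gd s); split=> //; exact: phi_deg_bij.
(* A nonconstant [g] involves a variable, which supplies the index [j] of the Koszul syzygy. *)
have n_gt0 : (0 < n)%N.
  rewrite lt0n; apply/eqP => n0; move: deg_g d_gt0.
  by rewrite (nvar0_mpolyC_eq g n0) msizeC; case: (_ != 0) => // -[<-].
have [k le_kd ak] := exists_small_syzygy (Ordinal n_gt0) (homogenize_homog le_gd).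
(* Classical reflection turns the existence of a nonzero syzygy into a boolean predicate, as
   [ex_minnP] requires. *)
have exP : exists k, `[< exists a : ARf f (Posz k), a != 0 >] by exists k; exact/asboolP.
have [r /asboolP r_f min_r] := ex_minnP exP.
have r_min : is_mdr_hom f (Posz r).
  split=> // -[k' a'|k' [a']]; first by rewrite lez_nat; apply: min_r; exact/asboolP.
  by rewrite (AR_hom_deg_neg a') eqxx.
exists (Posz r); split=> //.
  have [r_f' le_r] := r_min; split=> [|s /(ARf_ARg_neq0 dK le_gd) /le_r //].
  exact/(ARf_ARg_neq0 dK le_gd).
(* As d > 0, the integer d - 1 is the natural number [d.-1], and minimality compares [r] with the
   degree [k] of the small syzygy. *)
rewrite -(subnK d_gt0) PoszD addrK lez_nat subn1.
by apply: leq_trans le_kd; apply: min_r; exact/asboolP.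
Qed.
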